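(* Let $X \subset \Sigma^{\mathbb{Z}^2}$ be a nontrivial trace sparse subshift that has a direction of determinism. Then $X$ contains a singly periodic point, and thus $X$ has a rational nondeterministic direction.
   Context: A $\mathbb{Z}^2$-subshift is a nonempty closed shift-invariant subset of $\Sigma^{\mathbb{Z}^2}$, $\sigma^{\mathbf v}(x)_{\mathbf u} = x_{\mathbf u + \mathbf v}$, $\Sigma \ni 0$ finite. Nontrivial means having at least two points. The trace of $X$ is the set of all rows $y\in\Sigma^{\mathbb{Z}}$, $y_j = x_{(j,i)}$, of configurations $x \in X$ ($i\in\mathbb{Z}$); $X$ is trace sparse if every configuration of the trace has only finitely many nonzero symbols. A direction is a vector $\mathbf v \in \mathbb{R}^2\setminus\{(0,0)\}$ up to multiplication by positive reals; it is rational if it equals, as a direction, a vector of $\mathbb{Z}^2$. A half-plane in direction $\mathbf v$ is a half-plane $H\subset\mathbb{R}^2$ whose boundary is orthogonal to $\mathbf v$ and whose interior contains $-r\mathbf v$ for all large enough $r\in\mathbb{N}$. $X$ is deterministic in direction $\mathbf v$ (and $\mathbf v$ is a deterministic direction, or direction of determinism) if for every half-plane $H$ in direction $\mathbf v$ the map $x \mapsto x|_{H\cap\mathbb{Z}^2}$ is injective on $X$; otherwise $\mathbf v$ is a nondeterministic direction. A configuration $x$ is singly periodic if $\sigma^{\mathbf u}(x) = x$ for some $\mathbf u \neq \mathbf 0$ and its orbit under the $\mathbb{Z}^2$ shift action is infinite. *)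

(* Defs.v *)
From HB Require Import structures.
From mathcomp Require Import all_boot all_order all_algebra.
From mathcomp Require Import all_classical all_reals all_analysis.
Import Order.TTheory GRing.Theory Num.Theory.
Import numFieldNormedType.Exports.

Set Implicit Arguments.
Unset Strict Implicit.
Unset Printing Implicit Defensive.

Local Open Scope classical_set_scope.
Local Open Scope ring_scope.

Definition config (S : finType) : Type :=
  prod_topology (fun _ : int * int => discrete_topology S).

Definition zshift (S : finType) (v : int * int) (x : config S) : config S :=
  fun u => x (u + v).

Definition subshift (S : finType) (X : set (config S)) : Prop :=
  [/\ X !=set0, closed X & forall v, zshift v @` X `<=` X].

Definition nontrivial (S : finType) (X : set (config S)) : Prop :=
  exists x y, [/\ X x, X y & x <> y].

Definition trace (S : finType) (X : set (config S)) : set (int -> S) :=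
  [set y | exists x, X x /\ exists i : int, forall j : int, y j = x (j, i)].

Definition trace_sparse (S : finType) (zero : S) (X : set (config S)) : Prop :=
  forall y, trace X y -> finite_set [set j | y j <> zero].

Section plane.
Variable R : realType.

Definition dot (u v : R^o * R^o) : R := u.1 * v.1 + u.2 * v.2.

Definition embZ2 (u : int * int) : R^o * R^o := (u.1%:~R, u.2%:~R).

(* Both closed and open half-planes are allowed. *)
Definition half_plane (H : set (R^o * R^o)) : Prop :=
  exists w c, w <> 0 /\
    (H = [set u | dot u w <= c] \/ H = [set u | dot u w < c]).

Definition half_plane_in_direction (v : R^o * R^o) (H : set (R^o * R^o)) :
    Prop :=
  [/\ half_plane H,
      forall p q, (closure H `\` H°) p -> (closure H `\` H°) q ->
        dot (p - q) v = 0
    & \forall r \near \oo, H° (- r%:R *: v)].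

(* A direction is represented by any nonzero vector on its ray; the predicates
   below do not depend on the representative. *)
Definition direction (v : R^o * R^o) : Prop := v <> 0.

Definition same_direction (u v : R^o * R^o) : Prop :=
  exists a : R, 0 < a /\ u = a *: v.

Definition rational_direction (v : R^o * R^o) : Prop :=
  direction v /\ exists n : int * int, same_direction v (embZ2 n).

Definition deterministic (S : finType) (X : set (config S)) (v : R^o * R^o) :
    Prop :=
  forall H, half_plane_in_direction v H ->
    set_inj X (fun x : config S => sigL (embZ2 @^-1` H) x).

End plane.

Definition singly_periodic (S : finType) (x : config S) : Prop :=
  (exists u, u <> 0 /\ zshift u x = x) /\
  infinite_set (range (fun v => zshift v x)).

(* Main.v *)
Require Import Defs.
From mathcomp Require Import all_boot all_order all_algebra.
From mathcomp Require Import all_classical all_reals all_analysis.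
From mathcomp Require Import zify ring lra.

(** Let [v] be a direction of determinism. By compactness, a difference between two points of [X] at a cell is caused by
    a difference at a nearby cell that is lower with respect to [v]
    ([deterministic_window]). Comparing with the zero configuration, which lies
    in [X] because rows are finite, every nonzero cell starts an infinite
    backward path of nonzero cells with bounded steps and height tending to minus
    infinity. By sparseness such a path must leave every horizontal strip
    ([path_leaves]).

    Zorn's lemma gives a closed invariant [M] in [X] minimal among those with a
    nonzero point ([exists_minimal]), and sparseness gives a finite pattern in
    [M] that forces the rest of a wide horizontal band to be zero
    ([exists_isolated]). By minimality, this pattern recurs near every nonzero
    cell of [M]. Since a backward path cannot jump over the band, a copy of the
    pattern controls what passes from one side to the other. A backward path
    that starts at a nonzero cell of least height in the band cannot return to
    the band, so it escapes to one side forever, say upwards, and meets further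
    copies on its way ([next_copy]). In a limit, one finds points with copies of the pattern going
    down as well, at nonnegative heights ([exists_chained]). Below the copy at
    the origin, the nonzero cells of such a point have height bounded below
    ([chained_height]). But two such points that differ below the origin would
    have a backward path of differences confined there, with heights tending to
    minus infinity. Hence they coincide below the origin ([chained_eq]).
    Applying this to a point and to its translate by the vector from a copy to
    the next one yields a period, first on a lower half-plane and then, in a
    limit, everywhere ([exists_periodic]).

    The periodic point is nonzero with finite rows, so it has no horizontal
    period and its orbit is infinite. Its nonzero cells lie in a strip parallel
    to the period, so the rational direction orthogonal to the period is
    nondeterministic ([periodic_nondeterministic]). *)

Import Order.TTheory GRing.Theory Num.Theory.
Import numFieldNormedType.Exports.

Set Implicit Arguments.
Unset Strict Implicit.
Unset Printing Implicit Defensive.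

Local Open Scope classical_set_scope.
Local Open Scope ring_scope.

(** * Configurations and compactness *)

Definition in_box (n : nat) (u : int * int) : Prop :=
  (absz u.1 <= n)%N /\ (absz u.2 <= n)%N.

Definition agree (S : finType) (n : nat) (x y : config S) : Prop :=
  forall u, in_box n u -> x u = y u.

Section compactness.
Variable S : finType.
Implicit Types (x y z : config S) (X : set (config S)).

Lemma config_ext x y : (forall u, x u = y u) -> x = y.
Proof. by move=> xy; apply: functional_extensionality_dep. Qed.

Lemma zshiftE v x u : zshift v x u = x (u + v).
Proof. by []. Qed.

Lemma zshiftD u v x : zshift u (zshift v x) = zshift (u + v) x.
Proof. by apply: config_ext => w; rewrite !zshiftE addrA. Qed.

Lemma zshift0 x : zshift 0 x = x.
Proof. by apply: config_ext => w; rewrite zshiftE addr0. Qed.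

Lemma in_boxW m n u : (m <= n)%N -> in_box m u -> in_box n u.
Proof.
by move=> mn [u1 u2]; split; [exact: leq_trans mn | exact: leq_trans mn].
Qed.

Lemma in_box_ex u : exists n, in_box n u.
Proof.
by exists (maxn (absz u.1) (absz u.2)); split; rewrite leq_max leqnn ?orbT.
Qed.

Lemma in_boxD m n u v : in_box m u -> in_box n v -> in_box (m + n) (u + v).
Proof. by rewrite /in_box /= => -[? ?] [? ?]; split; lia. Qed.

Lemma in_boxN n u : in_box n u -> in_box n (- u).
Proof. by rewrite /in_box /= => -[? ?]; split; lia. Qed.

Lemma agreeW m n x y : (m <= n)%N -> agree n x y -> agree m x y.
Proof. by move=> mn xy u /(in_boxW mn); exact: xy. Qed.

Lemma agree_sym n x y : agree n x y -> agree n y x.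
Proof. by move=> xy u un; rewrite xy. Qed.

Lemma agree_trans n x y z : agree n x y -> agree n y z -> agree n x z.
Proof. by move=> xy yz u un; rewrite xy ?yz. Qed.

Lemma agree_shift m n u x y : in_box m u -> agree (n + m) x y ->
  agree n (zshift u x) (zshift u y).
Proof. by move=> um xy w wn; apply: xy; exact: in_boxD. Qed.

Lemma nbhs_cell x u : nbhs x [set y : config S | y u = x u].
Proof.
apply: (@proj_continuous _ (fun _ : int * int => discrete_topology S) u x
  [set a | a = x u]).
by rewrite nbhs_principalE; apply/principal_filterP.
Qed.

Lemma nbhs_agree n x : nbhs x [set y | agree n y x].
Proof.
pose I := [seq (k%:Z - n%:Z) | k <- iota 0 (n + n).+1].
have memI (j : int) : (absz j <= n)%N -> j \in I.
  move=> jn; apply/mapP; exists (absz (j + n%:Z)); last lia.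
  by rewrite mem_iota; lia.
suff : forall s : seq (int * int),
    nbhs x [set y : config S | forall u, u \in s -> y u = x u].
  move=> /(_ [seq (j, i) | j <- I, i <- I]); apply: filterS.
  move=> y yx [j i] [jn im].
  by apply: yx; apply: allpairs_f; exact: memI.
elim=> [|u s IH]; first by apply: filterS (@filterT _ (nbhs x) _) => y _ u.
apply: filterS (filterI (nbhs_cell x u) IH) => y /= [yu ys] w.
by rewrite inE => /orP[/eqP ->|/ys].
Qed.

Lemma compact_config : compact [set: config S].
Proof.
have := @tychonoff _ (fun _ : int * int => discrete_topology S) (fun _ => setT).
have -> : [set f : config S | forall i : int * int,
    [set: discrete_topology S] (f i)] = setT by apply/seteqP.
by apply=> _; apply: finite_compact; exact: (@finite_finset S).
Qed.

(** Sequential compactness of a closed set: the alphabet is finite, so the full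
    space of configurations is compact, and a cluster point is approached on
    every box. *)
Lemma limit_config X (s : nat -> config S) : closed X -> (forall n, X (s n)) ->
  exists x (phi : nat -> nat),
    X x /\ forall n, (n <= phi n)%N /\ agree n (s (phi n)) x.
Proof.
move=> clX Xs.
have cX : compact X := subclosed_compact clX compact_config (@subsetT _ X).
have [|x [Xx sx]] := cX (s @ \oo) _; first by exists 0%N => // n _; exact: Xs.
suff /choice[phi phiP] : forall n, exists k, (n <= k)%N /\ agree n (s k) x.
  by exists x, phi.
move=> n; have [|y [[k nk <-] yx]] :=
  sx (s @` [set k | (n <= k)%N]) _ _ (nbhs_agree n x).
  by exists n => // k /= nk; exists k.
by exists k.
Qed.

(** Two sequences converge along a common subsequence; this is what turns an
    agreement between two configurations into an agreement on a window. *)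
Lemma limit_config2 X (s t : nat -> config S) : closed X ->
  (forall n, X (s n)) -> (forall n, X (t n)) ->
  exists x y (phi : nat -> nat), [/\ X x, X y & forall n,
    [/\ (n <= phi n)%N, agree n (s (phi n)) x & agree n (t (phi n)) y]].
Proof.
move=> clX Xs Xt; have [x [phi [Xx phix]]] := limit_config clX Xs.
have [y [psi [Xy psiy]]] := limit_config clX (fun n => Xt (phi n)).
exists x, y, (phi \o psi); split=> // n /=.
have [nn ny] := psiy n; have [ff fx] := phix (psi n).
by split=> //; [exact: leq_trans ff | exact: agreeW fx].
Qed.

End compactness.

(** * Half-planes and heights *)

Section half_planes.
Variable R : realType.
Implicit Types (v : R^o * R^o) (u w : int * int).

(** The pairing with the normal [v]: in a direction of determinism, the value of
    a cell is decided by cells of smaller height. *)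
Definition height v u : R := dot (embZ2 R u) v.

Lemma heightD v u w : height v (u + w) = height v u + height v w.
Proof. by rewrite /height /dot /embZ2 /= !intrD; ring. Qed.

Lemma heightN v u : height v (- u) = - height v u.
Proof. by rewrite /height /dot /embZ2 /= !intrN; ring. Qed.

Lemma heightB v u w : height v (u - w) = height v u - height v w.
Proof. by rewrite heightD heightN. Qed.

Lemma height_box v : exists2 B : R, 0 <= B &
  forall n u, in_box n u -> - (n%:R * B) <= height v u.
Proof.
exists (`|v.1| + `|v.2|) => [|n u [u1 u2]]; first by rewrite addr_ge0.
have E (a : int) (t : R) : (absz a <= n)%N -> - (n%:R * `|t|) <= a%:~R * t.
  move=> an; apply: (@le_trans _ _ (- `|a%:~R * t|)); last first.
    by rewrite lerNl -normrN ler_norm.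
  rewrite lerN2 normrM ler_wpM2r// -intr_norm -(mulrz_nat n) ler_int.
  by lia.
have := E u.1 v.1 u1; have := E u.2 v.2 u2; rewrite /height /dot /embZ2 /=.
by move=> *; lra.
Qed.

Lemma continuous_dot v : continuous (fun p : R^o * R^o => dot p v : R^o).
Proof.
move=> p; rewrite /dot; apply: cvgD; apply: cvgMr_tmp.
- exact: cvg_fst.
- exact: cvg_snd.
Qed.

(** The closure of the open half-plane lies in the closed one, so its boundary
    is contained in a line orthogonal to [v]. *)
Lemma open_half_planeP v c : v <> 0 ->
  half_plane_in_direction v [set p | dot p v < c].
Proof.
move=> v0.
have oH : open [set p : R^o * R^o | dot p v < c].
  have -> : [set p : R^o * R^o | dot p v < c] =
      (fun p : R^o * R^o => dot p v : R^o) @^-1` [set t | t < c] by [].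
  by apply: open_comp => [p _|]; [exact: continuous_dot | exact: open_lt].
have cH : closed [set p : R^o * R^o | dot p v <= c].
  have -> : [set p : R^o * R^o | dot p v <= c] =
      (fun p : R^o * R^o => dot p v : R^o) @^-1` [set t | t <= c] by [].
  by apply: preimage_closed => [p _|]; [exact: continuous_dot | exact: closed_le].
have bd p : (closure [set p | dot p v < c] `\` [set p | dot p v < c]°) p ->
    dot p v = c.
  move=> []; rewrite (interior_id _).1//= => clp /negP; rewrite -leNgt => cp.
  apply/eqP; rewrite eq_le cp andbT.
  suff : closure [set p : R^o * R^o | dot p v < c] `<=`
      [set p : R^o * R^o | dot p v <= c] by apply.
  rewrite [X in _ `<=` X](closure_id _).1//; apply: closureS => q /=.
  exact: ltW.
split; first by exists v, c; split=> //; right.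
  move=> p q /bd pc /bd qc; move: pc qc; rewrite /dot /= => pc qc.
  by rewrite !mulrBl; lra.
have v2 : 0 < dot v v.
  rewrite /dot lt_neqAle addr_ge0 -?expr2 ?sqr_ge0// andbT eq_sym.
  rewrite paddr_eq0 ?sqr_ge0// !sqrf_eq0; apply/negP => /andP[/eqP a /eqP b].
  by apply: v0; rewrite (surjective_pairing v) a b.
exists (Num.truncn (`|c| / dot v v)).+1 => // r /= rc.
rewrite (interior_id _).1//=.
have : `|c| / dot v v < r%:R.
  by apply: lt_le_trans (truncnS_gt _) _; rewrite ler_nat.
rewrite ltr_pdivrMr// => cr.
have -> : dot (- r%:R *: v) v = - (r%:R * dot v v).
  by rewrite /dot /= /GRing.scale /=; ring.
by have := ler_norm (- c); rewrite normrN => ?; lra.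
Qed.

End half_planes.

(** * Sparse subshifts *)

Section sparse.
Variables (S : finType) (zero : S) (X : set (config S)).
Hypotheses (X_subshift : subshift X) (X_sparse : trace_sparse zero X).
Implicit Types (x y z : config S).

Lemma zshift_in v x : X x -> X (zshift v x).
Proof. by case: X_subshift => _ _ + Xx; apply; exists x. Qed.

Lemma strip_box (K : nat) x : X x ->
  exists J : nat, forall u, (absz u.2 <= K)%N -> x u <> zero -> in_box J u.
Proof.
move=> Xx.
have row (i : int) :
    exists J : nat, forall j, x (j, i) <> zero -> (absz j <= J)%N.
  have : trace X (fun j => x (j, i)) by exists x; split=> //; exists i.
  move=> /X_sparse/finite_seqP[s sE].
  exists (\max_(j <- s) absz j)%N => j xj.
  suff js : j \in s by exact: (@leq_bigmax_seq _ s predT absz).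
  by have : [set j | x (j, i) <> zero] j by []; rewrite sE.
have [J JP] := choice row.
exists (maxn K (\max_(k < K.+1) maxn (J k%:Z) (J (- k%:Z)))) => -[j i] /= iK xj.
split => /=; last by rewrite leq_max iK.
rewrite leq_max; apply/orP; right.
apply: leq_trans (JP i j xj) _.
have iK' : (absz i < K.+1)%N by [].
apply: leq_trans (@leq_bigmax _ (fun k : 'I_K.+1 => maxn (J k%:Z) (J (- k%:Z)))
  (Ordinal iK')).
rewrite /= leq_max; case: (leP 0 i) => i0.
  by have -> : i = (absz i)%:Z; [lia | rewrite absz_nat leqnn].
have {1 3}-> : i = - (absz i)%:Z by lia.
by rewrite leqnn orbT.
Qed.

(** Translating any configuration further and further along its rows pushes all
    its nonzero cells out of every box. *)
Lemma zero_in : X (fun=> zero).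
Proof.
have [[x Xx] clX _] := X_subshift.
have /choice[J JP] := fun K => strip_box K Xx.
have [y [phi [Xy phiy]]] :=
  limit_config clX (fun n => zshift_in (((J n).+1 + n)%N%:Z, 0) Xx).
suff -> : (fun=> zero) = y by [].
apply: config_ext => u.
have [n un] := in_box_ex u.
have [nphi <-] := phiy n; last by [].
rewrite zshiftE; apply: contrapT => /nesym/JP xu.
have [] := xu (phi n).
  by rewrite /= addr0; apply: leq_trans nphi; case: un.
by move: un => [] /=; lia.
Qed.

(** Existence of a minimal subshift among those that contain a nonzero point,
    stated for the open complement [U] so that Zorn's lemma applies to unions.
    The union of a chain stays admissible because the configurations that are
    nonzero at the origin form a compact set, and shift-invariance lets any
    nonzero configuration be moved into it. *)
Lemma exists_minimal : (exists x y, [/\ X x, X y & x <> y]) ->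
  exists U : set (config S),
  [/\ open U, forall v x, U x -> U (zshift v x),
    exists x, [/\ X x, ~ U x & x 0 <> zero] &
    forall V, open V -> (forall v x, V x -> V (zshift v x)) -> U `<` V ->
      forall x, X x -> x 0 <> zero -> V x].
Proof.
move=> [x0 [y0 [Xx0 Xy0 xy0]]].
have [_ clX _] := X_subshift.
pose A := X `&` [set x | x 0 <> zero].
have A0 : A !=set0.
  have nz x : X x -> x <> (fun=> zero) -> A !=set0.
    move=> Xx xz; have [u xu] : exists u, x u <> zero.
      by apply: contrapT => /forallNP xE; apply: xz; apply: config_ext => u;
        apply: contrapT => /xE.
    by exists (zshift u x); split; [exact: zshift_in | rewrite /= zshiftE add0r].
  have [xz|/nz] := pselect (x0 = fun=> zero); last exact.
  by apply: (nz _ Xy0) => yz; apply: xy0; rewrite xz yz.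
have clA : closed A.
  apply: closedI => //.
  have -> : [set x | x 0 <> zero] = ~` [set x : config S | x 0 = zero] by [].
  apply: open_closedC; rewrite openE => x /= x0E; rewrite /interior.
  by have := nbhs_cell x 0; rewrite x0E.
have cA : compact A := subclosed_compact clA (@compact_config S) (@subsetT _ A).
pose P (U : set (config S)) :=
  [/\ open U, forall v x, U x -> U (zshift v x) & A `\` U !=set0].
have [F FP Fchain|U [[oU sU [x [[Xx x0z] Ux]]] Umax]] := @Zorn_bigcup _ P.
  split.
  - by apply: bigcup_open => U /FP[].
  - by move=> v x [U FU Ux]; exists U => //; have [_ + _] := FP U FU; apply.
  - have [->|/set0P[U0 FU0]] := eqVneq F set0.
      by rewrite bigcup_set0 setD0.
    (* The traces on A of the complements of the members of the chain generate a
       filter, and a cluster point of it avoids the whole chain. *)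
    have FF : ProperFilter (filter_from F (fun U => A `\` U)).
      apply: filter_from_proper; last by move=> U /FP[].
      apply: filter_from_filter; first by exists U0.
      move=> U V FU FV; have [UV|VU] := Fchain U V FU FV.
        by exists V => // x [Ax Vx]; split; split=> // /UV.
      by exists U => // x [Ax Vx]; split; split=> // /VU.
    have [|x [Ax Fx]] := cA _ FF; first by exists U0 => // ? [].
    exists x; split=> // -[U FU Ux].
    have [] := Fx (A `\` U) U; first by exists U.
      by apply: open_nbhs_nbhs; split=> //; case: (FP U FU).
    by move=> y [[]].
exists U; split=> //; first by exists x.
move=> V oV sV UV y Xy y0z; apply: contrapT => Vy; apply: (Umax V UV).
by split=> //; exists y.
Qed.

(** By compactness, determinism is local: a difference between two
    configurations at [u] forces one in a fixed box around [u], and lower.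
    Determinism for the half-plane of height below [-1] rather than [0] gives a
    drop of at least one unit, so heights along repeated steps tend to minus
    infinity without any further estimate. *)
Lemma deterministic_window (R : realType) (v : R^o * R^o) :
  v <> 0 -> deterministic X v ->
  exists h : nat, forall x y u, X x -> X y -> x u <> y u ->
  exists f, [/\ in_box h f, height v f <= -1 & x (u + f) <> y (u + f)].
Proof.
move=> v0 detX; have [_ clX _] := X_subshift; apply: contrapT => /forallNP noh.
have /choice[s sP] : forall n, exists xy : config S * config S,
    [/\ X xy.1, X xy.2, xy.1 0 <> xy.2 0 & forall f, in_box n f ->
      height v f <= -1 -> xy.1 f = xy.2 f].
  move=> n; have /existsNP[x /existsNP[y /existsNP[u]]] := noh n.
  move=> /not_implyP[Xx /not_implyP[Xy /not_implyP[xy /forallNP nof]]].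
  exists (zshift u x, zshift u y); split=> /=; rewrite ?zshiftE ?add0r//.
  - exact: zshift_in.
  - exact: zshift_in.
  move=> f fn fv; apply: contrapT => xyf; apply: (nof f); split=> //.
  by move: xyf; rewrite !zshiftE (addrC f).
have [x [y [phi [Xx Xy phiP]]]] := @limit_config2 _ X (fun n => (s n).1)
  (fun n => (s n).2) clX (fun n => let: And4 a _ _ _ := sP n in a)
  (fun n => let: And4 _ a _ _ := sP n in a).
have [_ x0 y0] := phiP 0%N.
have [_ _ + _] := sP (phi 0%N); rewrite x0// y0//; apply.
suff -> : x = y by [].
apply: (detX _ (open_half_planeP (-1) v0)); rewrite ?inE//.
apply: functional_extensionality_dep => -[u uP]; rewrite /sigL /=.
have [n un] := in_box_ex u.
have [nphi xu yu] := phiP n; rewrite -xu// -yu//.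
have [_ _ _] := sP (phi n); apply; first exact: in_boxW un.
by have := uP; rewrite inE /= => /ltW.
Qed.

End sparse.

(** * Isolated patterns and backward paths *)

(** Discrete intermediate values, applied to the rows along a path with bounded
    steps: such a path cannot jump over a wide band. *)
Lemma int_crossing (e : nat -> int) (c : int) (h k : nat) :
  (forall k, (absz (e k.+1 - e k) <= h)%N) -> e 0%N <= c -> c <= e k ->
  exists k, (absz (e k - c) <= h)%N.
Proof.
move=> eh e0; elim: k => [ce0|k IH cek].
  by exists 0%N; lia.
have [/IH//|ekc] := leP c (e k).
by exists k; have := eh k; lia.
Qed.

(** If a witness exists for every configuration and only finitely many cells
    decide whether it is one, then compactness bounds the witnesses. *)
Lemma local_uniform (S : finType) (M : set (config S)) (Q : set (config S))
    (P : int * int -> set (config S)) : closed M ->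
  (exists n, forall x y, agree n x y -> Q x -> Q y) ->
  (forall q, exists n, forall x y, agree n x y -> P q x -> P q y) ->
  (forall x, M x -> Q x -> exists q, P q x) ->
  exists r, forall x, M x -> Q x -> exists q, in_box r q /\ P q x.
Proof.
move=> clM [nQ Qloc] Ploc MQP; apply: contrapT => /forallNP nor.
have /choice[s sP] : forall n, exists x,
    [/\ M x, Q x & forall q, in_box n q -> ~ P q x].
  move=> n; have /existsNP[x /not_implyP[Mx /not_implyP[Qx noq]]] := nor n.
  by exists x; split=> // q qn Pq; apply: noq; exists q.
have [x [phi [Mx phix]]] :=
  limit_config clM (fun n => let: And3 a _ _ := sP n in a).
have [|q Pq] := MQP _ Mx.
  by have [_ /Qloc] := phix nQ; apply; have [] := sP (phi nQ).
have [nP Pl] := Ploc q.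
pose n := maxn nP (maxn (absz q.1) (absz q.2)).
have [nphi /agree_sym/(agreeW (leq_maxl _ _))/Pl/(_ Pq)] := phix n.
have [_ _] := sP (phi n); apply; apply: in_boxW nphi _.
by split; rewrite !leq_max leqnn ?orbT.
Qed.

Section isolated.
Variables (S : finType) (zero : S) (X M : set (config S)).
Hypotheses (X_sparse : trace_sparse zero X).
Hypotheses (clM : closed M) (MX : M `<=` X).

(** Some finite pattern forces the rest of a horizontal band to be zero.
    Otherwise each pattern would extend to a configuration with a further nonzero
    cell of the band outside the pattern, and the limit of such extensions
    would have infinitely many nonzero cells in the band. *)
Lemma exists_isolated (K : nat) : (exists x, M x /\ x 0 <> zero) ->
  exists z (m : nat), [/\ M z, z 0 <> zero, (K <= m)%N &
    forall x, M x -> agree m x z ->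
    forall u, (absz u.2 <= K)%N -> x u <> zero -> in_box m u].
Proof.
move=> [x0 [Mx0 x00]]; apply: contrapT => noz.
pose good (p : config S * nat) := [/\ M p.1, p.1 0 <> zero & (K <= p.2)%N].
(* One extension step; the new box contains the old one and the new cell u. *)
have /choice[g gP] : forall p, exists p', good p ->
    [/\ good p', (p.2 < p'.2)%N, agree p.2 p'.1 p.1 & exists u,
      [/\ (absz u.2 <= K)%N, p'.1 u <> zero, ~ in_box p.2 u & in_box p'.2 u]].
  move=> [z m]; have [[/= Mz z0 Km]|] := pselect (good (z, m)).
    2: by exists (z, m).
  have /existsNP[x /not_implyP[Mx /not_implyP[xz]]] : ~ (forall x, M x ->
      agree m x z -> forall u, (absz u.2 <= K)%N -> x u <> zero -> in_box m u).
    by move=> iso; apply: noz; exists z, m.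
  move=> /existsNP[u /not_implyP[uK /not_implyP[xu um]]].
  exists (x, (m + absz u.1 + absz u.2).+1) => _; split=> /=.
  - split=> //=; last by lia.
    by rewrite xz//; split; rewrite leq0n.
  - by lia.
  - by [].
  - by exists u; split=> //; split; lia.
pose s k := iter k g (x0, K).
have sgood k : good (s k) by elim: k => [//|k /gP[]].
have sS k : s k.+1 = g (s k) by [].
have sk k : (k <= (s k).2)%N.
  by elim: k => [//|k IH]; rewrite sS; have [_ + _ _] := gP _ (sgood k); lia.
have sD k d : agree (s k).2 (s (k + d)%N).1 (s k).1 /\
    ((s k).2 <= (s (k + d)%N).2)%N.
  elim: d => [|d [IH1 IH2]]; first by rewrite addn0.
  rewrite addnS sS; have [_ lt ag _] := gP _ (sgood (k + d)%N).
  by split; [apply: agree_trans IH1; exact: agreeW ag | lia].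
have [x [phi [Mx phix]]] :=
  @limit_config _ M (fun n => (s n).1) clM
    (fun n => let: And3 a _ _ := sgood n in a).
have [J JP] := strip_box X_sparse K (MX Mx).
have [_ _ _ [u [uK su uJ uJ']]] := gP _ (sgood J).
have [nphi px] := phix (maxn J.+1 (s J.+1).2).
have xu : x u <> zero.
  rewrite -px; last by apply: in_boxW uJ'; rewrite -sS leq_max leqnn orbT.
  rewrite -(subnK (leq_trans (leq_maxl _ _) nphi)) addnC.
  by have [->] := sD J.+1 (phi (maxn J.+1 (s J.+1).2) - J.+1)%N.
by apply: uJ; apply: in_boxW (sk J) _; exact: JP.
Qed.

End isolated.

Section paths.
Variables (R : realType) (S : finType) (zero : S) (X : set (config S)).
Variables (v : R^o * R^o) (h : nat).
Hypotheses (X_sparse : trace_sparse zero X).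
Hypothesis window : forall x y u, X x -> X y -> x u <> y u ->
  exists f, [/\ in_box h f, height v f <= -1 & x (u + f) <> y (u + f)].
Implicit Types (x y z : config S).

(** A trail of differences followed against the direction of determinism. For
    [y] the zero configuration, it is a trail of nonzero cells of [x]. *)
Definition backward_path x y (w : nat -> int * int) : Prop :=
  forall k, [/\ x (w k) <> y (w k), in_box h (w k.+1 - w k) &
    height v (w k) <= height v (w 0%N) - k%:R].

Lemma exists_path x y u : X x -> X y -> x u <> y u ->
  exists w, w 0%N = u /\ backward_path x y w.
Proof.
move=> Xx Xy xyu.
have /choice[g gP] : forall u, exists u', x u <> y u ->
    [/\ x u' <> y u', in_box h (u' - u) & height v u' <= height v u - 1].
  move=> {xyu}u; have [xy|] := pselect (x u <> y u); last by exists u.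
  have [f [fh fv xyf]] := window Xx Xy xy.
  exists (u + f) => _; split=> //; first by rewrite addrAC subrr add0r.
  by rewrite heightD lerD2l.
exists (fun k => iter k g u); split=> // k.
have xyk j : x (iter j g u) <> y (iter j g u) by elim: j => [//|j /gP[]].
split=> //; first by have [] := gP _ (xyk k).
elim: k => [|k IH]; first by rewrite subr0.
by have [_ _] := gP _ (xyk k); rewrite -natr1 /= in IH *; lra.
Qed.

(** A horizontal strip contains finitely many nonzero cells of [x] and [y], so
    heights of differences are bounded below in it, whereas heights along the
    path are unbounded below. *)
Lemma path_leaves x y w (K : nat) : X x -> X y -> backward_path x y w ->
  exists k0, forall k, (k0 <= k)%N -> (K < absz (w k).2)%N.
Proof.
move=> Xx Xy wP; have [B B0 BP] := height_box v.
have [J JP] := strip_box X_sparse K Xx.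
have [J' JP'] := strip_box X_sparse K Xy.
exists (Num.truncn (height v (w 0%N) + (maxn J J')%:R * B)).+1 => k.
rewrite -(ler_nat R) => k0k.
have /(lt_le_trans (truncnS_gt _)) := k0k => lt.
rewrite ltnNge; apply/negP => wK; have [xy _ wk] := wP k.
have wb : in_box (maxn J J') (w k).
  have [xz|xz] := pselect (x (w k) = zero).
    apply: in_boxW (leq_maxr _ _) _; apply: JP' => // yz.
    by apply: xy; rewrite xz yz.
  by apply: in_boxW (leq_maxl _ _) _; exact: JP.
by have := BP _ _ wb; lra.
Qed.

End paths.

(** * Copies of an isolated pattern *)

(** Throughout, [M] is closed and shift-invariant, [z] is nonzero only inside
    the box of size [m] on the band of rows at most [h + h], any point of [M]
    that agrees with [z] on that box does the same, and every nonzero point of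
    [M] contains a copy of this pattern. A copy thus isolates what lies above
    its band from what lies below. The cell [w0] is a nonzero cell of [z] outside
    the inner band of rows at most [h] and not higher than any nonzero cell of
    that inner band: a backward path starting at [w0] can neither enter the
    inner band nor, its steps being at most [h], jump over it. [level] is the row
    number, or its opposite, with the sign for which [w0] has positive level. *)
Section chains.
Variables (R : realType) (S : finType) (zero : S) (X M : set (config S)).
Variables (v : R^o * R^o) (h : nat).
Hypotheses (X_sparse : trace_sparse zero X).
Hypothesis window : forall x y u, X x -> X y -> x u <> y u ->
  exists f, [/\ in_box h f, height v f <= -1 & x (u + f) <> y (u + f)].
Hypotheses (X_zero : X (fun=> zero)) (MX : M `<=` X) (clM : closed M).
Hypothesis M_shift : forall u x, M x -> M (zshift u x).

Variables (z : config S) (m : nat).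
Hypotheses (Mz : M z) (hm : (h + h <= m)%N).
Hypothesis isolated : forall x, M x -> agree m x z ->
  forall u, (absz u.2 <= h + h)%N -> x u <> zero -> in_box m u.
Hypothesis recurrent : forall x, M x -> x 0 <> zero ->
  exists q, agree m (zshift q x) z.

Variable level : int * int -> int.
Hypothesis levelD : forall u w, level (u + w) = level u + level w.
Hypothesis level_abs : forall u, absz (level u) = absz u.2.

Variable w0 : int * int.
Hypotheses (z_w0 : z w0 <> zero) (w0_gt : (h%:Z < level w0)%R)
  (w0_le : (level w0 <= (h + h)%:Z)%R).
Hypothesis w0_barrier : forall u, z u <> zero -> (absz u.2 <= h)%N ->
  height v w0 <= height v u.

Implicit Types (x y : config S).

Lemma level0 : level 0 = 0.
Proof. by have := level_abs 0; rewrite /=; lia. Qed.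

Lemma levelN u : level (- u) = - level u.
Proof. by have := levelD u (- u); rewrite subrr level0; lia. Qed.

Lemma levelB u w : level (u - w) = level u - level w.
Proof. by rewrite levelD levelN. Qed.

Lemma level_step n u w : in_box n (u - w) -> (absz (level u - level w) <= n)%N.
Proof. by rewrite -levelB level_abs => -[]. Qed.

(** Outside the box of size [m], both sides are zero on the band. *)
Lemma band_eq x u : M x -> agree m x z -> (absz u.2 <= h + h)%N -> x u = z u.
Proof.
move=> Mx xz uh; have [um|um] := pselect (in_box m u); first exact: xz.
have -> : x u = zero by apply: contrapT => /(isolated Mx xz uh).
by apply: contrapT => /nesym/(isolated Mz (fun=> fun=> erefl) uh).
Qed.

Lemma uniformly_recurrent : exists r, forall x, M x -> x 0 <> zero ->
  exists q, in_box r q /\ agree m (zshift q x) z.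
Proof.
apply: (local_uniform (Q := [set x | x 0 <> zero])
  (P := fun q x => agree m (zshift q x) z)) recurrent => //.
  by exists 0%N => x y xy /=; rewrite xy//; split.
move=> q; exists (m + (absz q.1 + absz q.2))%N => x y xy; apply: agree_trans.
by apply/agree_sym/agree_shift/xy; split; lia.
Qed.

(** The backward path from [w0] is trapped above the inner band, and it leaves
    every strip, so its level tends to infinity while its height tends to minus
    infinity. Far along the path, recurrence gives a new copy of the pattern. *)
Lemma next_copy x : M x -> agree m x z ->
  exists q, [/\ 1 <= level q, height v q <= -1 & agree m (zshift q x) z].
Proof.
move=> Mx xz.
have xw0 : x w0 <> zero.
  by rewrite (band_eq Mx xz)// -level_abs; move: w0_gt w0_le; lia.
have [w [ww0 wP]] := exists_path window (MX Mx) X_zero xw0.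
have wup k : h%:Z < level (w k).
  elim: k => [|k IH]; first by rewrite ww0.
  have [_ wh _] := wP k; have [xk _ hk] := wP k.+1.
  have := level_step wh => step.
  have up : 0 < level (w k.+1) by lia.
  rewrite ltNge; apply/negP => le.
  have le2 : (absz (w k.+1).2 <= h)%N by rewrite -level_abs; lia.
  have zk : z (w k.+1) <> zero by rewrite -(band_eq Mx xz)//; lia.
  have := w0_barrier zk le2; rewrite ww0 in hk.
  by have := ltr0Sn R k; lra.
have [r rP] := uniformly_recurrent.
have [k0 k0P] := path_leaves X_sparse r (MX Mx) X_zero wP.
have [B B0 BP] := height_box v.
pose k := maxn k0 (Num.truncn (height v w0 + r%:R * B + 1)).+1.
have [xk _ hk] := wP k.
have [q [qr qz]] :
    exists q, in_box r q /\ agree m (zshift q (zshift (w k) x)) z.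
  by apply: rP; [exact: M_shift | rewrite zshiftE add0r].
exists (q + w k); split; last by rewrite -zshiftD.
- have := k0P k (leq_maxl _ _); have := wup k; rewrite levelD -level_abs.
  by move: qr => [_]; rewrite -level_abs; lia.
- rewrite heightD; have := BP _ _ (in_boxN qr); rewrite heightN.
  have : height v w0 + r%:R * B + 1 < k%:R.
    by apply: lt_le_trans (truncnS_gt _) _; rewrite ler_nat leq_maxr.
  by rewrite ww0 in hk; lra.
Qed.

(** Configurations with copies of the pattern at arbitrarily low levels and at
    nonnegative heights: whatever lies between two copies is walled in. *)
Definition chained x : Prop := [/\ M x, agree m x z &
  forall n : nat, exists p,
    [/\ level p <= - n%:Z, 0 <= height v p & agree m (zshift p x) z]].

(** Iterating [next_copy] from [z] and recentering at the last copy found puts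
    all previous copies below the origin; a uniform bound on the distance between
    successive copies lets them survive in the limit. *)
Lemma exists_chained : exists x, chained x.
Proof.
have [K KP] : exists K, forall x, M x -> agree m x z -> exists q, in_box K q /\
    [/\ 1 <= level q, height v q <= -1 & agree m (zshift q x) z].
  apply: (local_uniform (Q := [set x | agree m x z]) (P := fun q x =>
    [/\ 1 <= level q, height v q <= -1 & agree m (zshift q x) z]))
    next_copy => //.
    by exists m => x y /agree_sym; exact: agree_trans.
  move=> q; exists (m + (absz q.1 + absz q.2))%N => x y xy [lq hq xz].
  split=> //.
  by apply: agree_trans xz; apply/agree_sym/agree_shift/xy; split; lia.
have /choice[g gP] : forall x, exists q, M x -> agree m x z -> in_box K q /\
    [/\ 1 <= level q, height v q <= -1 & agree m (zshift q x) z].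
  move=> x; have [[Mx xz]|nx] := pselect (M x /\ agree m x z).
    by have [q qP] := KP x Mx xz; exists q.
  by exists 0 => Mx xz; case: nx.
pose s n := iter n (fun x => zshift (g x) x) z.
have sP n : M (s n) /\ agree m (s n) z.
  elim: n => [|n [Ms sz]]; first by split.
  by split; [exact: M_shift | have [_ []] := gP _ Ms sz].
have back n N : exists p, [/\ in_box (n * K) p, level p <= - n%:Z,
    0 <= height v p & zshift p (s (n + N)%N) = s N].
  elim: n => [|n [p [pK pn hp ps]]].
    exists 0; split=> //; first by rewrite level0.
      by have := heightN v 0; rewrite oppr0 => ?; lra.
    exact: zshift0.
  have [Ms sz] := sP (n + N)%N; have [qK [lq hq _]] := gP _ Ms sz.
  exists (p - g (s (n + N)%N)); split.
  - by rewrite mulSn addnC; apply: in_boxD => //; exact: in_boxN.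
  - by rewrite levelB; lia.
  - by rewrite heightB; lra.
  - by rewrite addSn /s iterS -/(s _) zshiftD subrK.
have [x [phi [Mx phix]]] := limit_config clM (fun n => proj1 (sP n)).
exists x; split=> //.
  have [_ /agree_sym xs] := phix m.
  by apply: agree_trans xs _; case: (sP (phi m)).
move=> n; pose j := (m + n * K + n)%N.
have [jphi xj] := phix j.
have [p [pK pn hp ps]] := back n (phi j - n)%N.
exists p; split=> //; rewrite subnKC in ps; last by lia.
apply: (@agree_trans _ _ _ (zshift p (s (phi j)))).
  by apply: agree_shift pK _; apply/agree_sym/(agreeW _ xj); lia.
by rewrite ps; case: (sP (phi j - n)%N).
Qed.

Lemma chained_shift x q : chained x -> 0 <= level q -> height v q <= 0 ->
  agree m (zshift q x) z -> chained (zshift q x).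
Proof.
move=> [Mx xz xP] lq hq qz; split=> //; first exact: M_shift.
move=> n; have [p [pn hp pz]] := xP n.
exists (p - q); split; rewrite ?zshiftD ?subrK//.
- by rewrite levelB; lia.
- by rewrite heightB; lra.
Qed.

(** A backward path from a nonzero cell [u] of nonpositive level leaves the
    strip between the copy at the origin and a copy below [u], so it meets the
    band of one of them. There it can only be in the box of that copy, whose
    height is bounded below, and the height of [u] is larger still. *)
Lemma chained_height : exists C : R, forall x u, chained x -> x u <> zero ->
  level u <= 0 -> - C <= height v u.
Proof.
have [B B0 BP] := height_box v; exists (m%:R * B) => x u [Mx xz xP] xu u0.
have [p [pu hp pz]] := xP (absz (level u)).
have [w [wu wP]] := exists_path window (MX Mx) X_zero xu.
have wh k : (absz (level (w k.+1) - level (w k)) <= h)%N.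
  by apply: level_step; case: (wP k).
suff cross q : agree m (zshift q x) z -> 0 <= height v q ->
    (exists k, absz (level (w k) - level q) <= h)%N ->
    - (m%:R * B) <= height v u.
  have [k0 k0P] := path_leaves X_sparse (absz (level p)) (MX Mx) X_zero wP.
  have := k0P _ (leqnn _); rewrite -level_abs => k0p.
  have [lk|lk] := leP 0 (level (w k0)).
    apply: (cross 0); rewrite ?zshift0// ?level0.
      by have := heightN v 0; rewrite oppr0 => ?; lra.
    by apply: int_crossing wh _ lk; rewrite wu.
  apply: (cross p) => //.
  have [|||k kP] := @int_crossing (fun k => - level (w k)) (- level p) h k0.
  - by move=> k; have := wh k; lia.
  - by rewrite wu; lia.
  - by lia.
  - by exists k; lia.
move=> qz hq [k kh]; have [xk _ hk] := wP k.
have wm : in_box m (w k - q).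
  apply: (isolated (M_shift q Mx) qz); last by rewrite zshiftE subrK.
  by rewrite -level_abs levelB; lia.
have := BP _ _ wm; rewrite heightB; rewrite wu in hk.
by have := ler0n R k; lra.
Qed.

(** The band of the copy at the origin is common to both configurations, so a
    backward path of differences starting below it stays below it. Its heights
    would be unbounded below, against [chained_height]. *)
Lemma chained_eq x y u : chained x -> chained y -> level u <= (h + h)%:Z ->
  x u = y u.
Proof.
move=> xP yP uh; apply: contrapT => xyu.
have [Mx xz _] := xP; have [My yz _] := yP.
have [w [wu wP]] := exists_path window (MX Mx) (MX My) xyu.
have jump k : level (w k) <= (h + h)%:Z -> level (w k) < - (h + h)%:Z.
  move=> le; rewrite ltNge; apply/negP => ge; have [+ _ _] := wP k; apply.
  have wk : (absz (w k).2 <= h + h)%N by rewrite -level_abs; lia.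
  by rewrite (band_eq Mx xz wk) (band_eq My yz wk).
have below k : level (w k) < - (h + h)%:Z.
  apply: (jump); elim: k => [|k /jump IH]; first by rewrite wu.
  by have [_ /level_step wk _] := wP k; lia.
have [C CP] := chained_height.
pose k := (Num.truncn (height v u + C)).+1.
have [xyk _ hk] := wP k; have lk := below k.
have kC : height v u + C < k%:R := truncnS_gt _.
have : - C <= height v (w k).
  have [xk|xk] := pselect (x (w k) = zero); last by apply: CP xk _ => //; lia.
  by apply: (CP y) => //; [move=> yk; apply: xyk; rewrite xk yk | lia].
by rewrite wu in hk; lra.
Qed.

(** A chained configuration recentered at its next copy is still chained, hence
    has the same lower half by [chained_eq]: it is periodic there. Recentering
    further and further down makes the periodic part exhaust the plane. *)
Lemma exists_periodic : z 0 <> zero ->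
  exists x q, [/\ M x, x 0 <> zero, q.2 <> 0 & zshift q x = x].
Proof.
move=> z0; have [x xP] := exists_chained; have [Mx xz _] := xP.
have [q [lq hq qz]] := next_copy Mx xz.
have qP : chained (zshift q x) by apply: chained_shift => //; [lia | lra].
have per u : level u <= (h + h)%:Z -> x (u + q) = x u.
  by move=> uh; rewrite -zshiftE; exact: chained_eq.
have levelM k : k%:Z <= level (q *+ k).
  elim: k => [|k IH]; first by rewrite mulr0n level0.
  by rewrite mulrSr levelD (_ : k.+1%:Z = k%:Z + 1) ?lerD//; lia.
have [y [phi [My yP]]] := limit_config clM (fun n => M_shift (- (q *+ n)) Mx).
exists y, q; split=> //.
- have [_ <-] := yP 0%N; last by split.
  rewrite zshiftE add0r.
  have -> k : x (- (q *+ k)) = x 0.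
    elim: k => [|k <-]; first by rewrite mulr0n oppr0.
    rewrite -[LHS]per.
      by rewrite mulrS opprD addrAC addNr add0r.
    by rewrite levelN; have := levelM k.+1; lia.
  by rewrite xz//; split; rewrite leq0n.
- by move=> q2; have := level_abs q; rewrite q2; lia.
- apply: config_ext => u; rewrite zshiftE.
  pose n := (absz u.1 + absz u.2 + (absz q.1 + absz q.2))%N.
  have [nphi yn] := yP n.
  rewrite -!yn; [|by split; rewrite /n /=; lia..].
  rewrite !zshiftE addrAC; apply: per.
  rewrite levelB; have := levelM (phi n); have := level_abs u.
  by move: nphi; rewrite /n; lia.
Qed.

End chains.

(** * Singly periodic points and nondeterminism *)

(** Take a nonzero cell of the inner band whose height is within one unit of the
    infimum, and step back once: the drop of one unit rules out the inner band. *)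
Lemma exists_barrier (R : realType) (S : finType) (zero : S)
    (X : set (config S)) (v : R^o * R^o) (h : nat) (z : config S) :
  trace_sparse zero X ->
  (forall x y u, X x -> X y -> x u <> y u ->
    exists f, [/\ in_box h f, height v f <= -1 & x (u + f) <> y (u + f)]) ->
  X (fun=> zero) -> X z -> z 0 <> zero ->
  exists w, [/\ z w <> zero, (h < absz w.2 <= h + h)%N &
    forall u, z u <> zero -> (absz u.2 <= h)%N -> height v w <= height v u].
Proof.
move=> X_sparse window X_zero Xz z0.
have [J JP] := strip_box X_sparse h Xz; have [B B0 BP] := height_box v.
have [u [zu uh umin]] : exists u, [/\ z u <> zero, (absz u.2 <= h)%N &
    forall u', z u' <> zero -> (absz u'.2 <= h)%N ->
    height v u - 1 < height v u'].
  apply: contrapT => /forallNP nomin.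
  have low n : exists u, [/\ z u <> zero, (absz u.2 <= h)%N &
      height v u <= height v 0 - n%:R].
    elim: n => [|n [u [zu uh un]]]; first by exists 0; rewrite subr0; split.
    apply: contrapT => nolow; apply: (nomin u); split=> // u' zu' u'h.
    rewrite ltNge; apply/negP => le; apply: nolow; exists u'; split=> //.
    by rewrite -natr1; lra.
  have [u [zu uh un]] := low (Num.truncn (height v 0 + J%:R * B)).+1.
  have := BP _ _ (JP _ uh zu); have := truncnS_gt (height v 0 + J%:R * B).
  by lra.
have [f [fh fv zf]] := window _ _ _ Xz X_zero zu.
have fu : height v (u + f) <= height v u - 1 by rewrite heightD; lra.
exists (u + f); split=> //.
2: by move=> u' zu' u'h; have := umin _ zu' u'h; lra.
apply/andP; split; last by move: fh => [_]; rewrite /=; lia.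
by rewrite ltnNge; apply/negP => le; have := umin _ zf le; lra.
Qed.

Section periodic.
Variables (R : realType) (S : finType) (zero : S) (X : set (config S)).
Hypotheses (X_subshift : subshift X) (X_sparse : trace_sparse zero X).

Lemma exists_periodic_config (v : R^o * R^o) : v <> 0 -> nontrivial X ->
  deterministic X v ->
  exists x q, [/\ X x, x 0 <> zero, q.2 <> 0 & zshift q x = x].
Proof.
move=> v0 ntX detX; have [_ clX _] := X_subshift.
have X_zero := zero_in X_subshift X_sparse.
have [h window] := deterministic_window X_subshift v0 detX.
have [U [oU sU [x1 [Xx1 Ux1 x10]] Umax]] :=
  exists_minimal zero X_subshift ntX.
pose M := X `&` ~` U.
have MX : M `<=` X by move=> x [].
have clM : closed M by apply: closedI => //; exact: open_closedC.
have M_shift u x : M x -> M (zshift u x).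
  move=> [Xx Ux]; split; first exact: zshift_in.
  by move=> /(sU (- u)); rewrite zshiftD addNr zshift0.
have [|z [m [Mz z0 hm isolated]]] := exists_isolated X_sparse clM MX (h + h).
  by exists x1.
(* Adding to U all configurations that contain the pattern of z gives an open
   invariant set strictly larger than U, hence one that contains all points of X
   that are nonzero at the origin. *)
have recurrent x : M x -> x 0 <> zero -> exists q, agree m (zshift q x) z.
  move=> [Xx Ux] x0.
  have [|||/Ux//|//] :=
    Umax (U `|` [set x | exists q, agree m (zshift q x) z]) _ _ _ x Xx x0.
  - apply: openU => //; rewrite openE => y [q yz].
    apply: filterS (nbhs_agree (m + (absz q.1 + absz q.2)) y) => y' yy'.
    by exists q; apply: agree_trans yz; apply: agree_shift yy'; split; lia.
  - move=> u y [/(sU u)|[q yz]]; first by left.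
    by right; exists (q - u); rewrite zshiftD subrK.
  - split=> [y Uy|UU]; first by left.
    by case: Mz => _; apply; apply: UU; right; exists 0; rewrite zshift0.
have [w [zw wh wbar]] := exists_barrier X_sparse window X_zero (MX _ Mz) z0.
have [x [q [Mx x0 q2 xq]]] : exists x q,
    [/\ M x, x 0 <> zero, q.2 <> 0 & zshift q x = x].
  have periodic level levelD level_abs w_gt w_le := exists_periodic X_sparse
    window X_zero MX clM M_shift Mz hm isolated recurrent (level := level) levelD
    level_abs zw w_gt w_le wbar z0.
  (* The side of the band on which w lies decides which way is upwards. *)
  have [w2|w2] := leP 0 w.2.
    by apply: (periodic (fun u => u.2)) => //=; lia.
  by apply: (periodic (fun u => - u.2)) => //= *; lia.
by exists x, q; split=> //; exact: MX.
Qed.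

(** Two equal horizontal translates would make a row periodic, and it has a
    nonzero cell. *)
Lemma infinite_orbit x : X x -> x 0 <> zero ->
  infinite_set (range (fun v => zshift v x)).
Proof.
move=> Xx x0 fin.
suff inj : injective (fun n : nat => zshift (n%:Z, 0) x).
  apply: infinite_nat.
  have := @finite_preimage _ _ _ (fun n : nat => zshift (n%:Z, 0) x) _ fin.
  rewrite (_ : _ @^-1` _ = setT); first by apply=> n n' _ _; exact: inj.
  by apply/seteqP; split=> // n _; exact: (@imageT _ _ (fun v => zshift v x)).
suff lt n n' : (n < n')%N -> zshift (n%:Z, 0) x <> zshift (n'%:Z, 0) x.
  by move=> n n'; case: (ltngtP n n') => // /lt nn' /esym // /nn'.
move=> nn' eq; have [J JP] := strip_box X_sparse 0 Xx.
have per u : x (u + ((n' - n)%N%:Z, 0)) = x u.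
  have := congr1 (fun y : config S => y (u - (n%:Z, 0))) eq.
  rewrite !zshiftE subrK => ->; congr x; rewrite -addrA; congr (_ + _).
  by apply/eqP; rewrite xpair_eqE /=; apply/andP; split; apply/eqP; lia.
have nz k : x ((k * (n' - n))%N%:Z, 0) <> zero.
  elim: k => [|k IH]; first by rewrite mul0n.
  move: IH; rewrite -per; congr (x _ <> _).
  by apply/eqP; rewrite xpair_eqE /= addr0 eqxx andbT; apply/eqP; lia.
by have [] := JP _ _ (nz J.+1); rewrite //=; nia.
Qed.

(** The nonzero cells of each row are finitely many and repeat along [q], so all
    of them lie in a strip parallel to [q]. A half-plane with boundary parallel
    to [q] that misses the strip cannot tell the configuration from zero. *)
Lemma periodic_nondeterministic x q : X x -> x 0 <> zero -> q.2 <> 0 ->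
  zshift q x = x ->
  exists v : R^o * R^o, rational_direction v /\ ~ deterministic X v.
Proof.
move=> Xx x0 q2 xq.
pose v : R^o * R^o := embZ2 R (- q.2, q.1).
have v0 : v <> 0.
  move=> /(congr1 fst)/eqP; rewrite /v /embZ2 /= intr_eq0 oppr_eq0.
  by move=> /eqP.
exists v; split.
  split=> //; exists (- q.2, q.1); exists 1; split; first exact: ltr01.
  by rewrite scale1r.
have hq : height v q = 0.
  by rewrite /height /dot /v /embZ2 /= intrN; ring.
have perD u : x (u + q) = x u by rewrite -[in RHS]xq.
have perB u : x (u - q) = x u by rewrite -perD subrK.
have [J JP] := strip_box X_sparse (absz q.2) Xx.
have [B B0 BP] := height_box v.
have low u : x u <> zero -> - (J%:R * B) <= height v u.
  move: {2}(absz u.2).+1 (ltnSn (absz u.2)) => n.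
  (* Adding or subtracting q lowers the absolute row number down to that of q. *)
  elim: n u => // n IH u un xu.
  have [uq|qu] := leqP (absz u.2) (absz q.2); first exact: BP (JP _ uq xu).
  have [s|s] : (absz (u.2 - q.2)%R < n)%N \/ (absz (u.2 + q.2)%R < n)%N by lia.
    by have := IH (u - q); rewrite perB heightB hq subr0; exact.
  by have := IH (u + q); rewrite perD heightD hq addr0; exact.
move=> detX; apply: x0.
suff -> : x = (fun=> zero) by [].
apply: (detX _ (open_half_planeP (- (J%:R * B)) v0)); rewrite ?inE//.
  exact: zero_in.
apply: functional_extensionality_dep => -[u uP]; rewrite /sigL /=.
apply: contrapT => /low; rewrite leNgt => /negP; apply.
by have := uP; rewrite inE.
Qed.

End periodic.

Theorem proposition6p13 (R : realType) (S : finType) (zero : S)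
    (X : set (config S)) (X_subshift : subshift X) (X_nontrivial : nontrivial X)
    (X_sparse : trace_sparse zero X)
    (X_det : exists v : R^o * R^o, direction v /\ deterministic X v) :
  (exists x : config S, X x /\ singly_periodic x) /\
  (exists v : R^o * R^o, rational_direction v /\ ~ deterministic X v).
Proof.
have [v [v0 detX]] := X_det.
have [x [q [Xx x0 q2 xq]]] :=
  exists_periodic_config X_subshift X_sparse v0 X_nontrivial detX.
split; last exact: (periodic_nondeterministic R X_subshift X_sparse Xx x0 q2 xq).
exists x; split=> //; split; last exact: (infinite_orbit X_sparse Xx x0).
by exists q; split=> // q0; apply: q2; rewrite q0.
Qed.
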